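(* Let $F=F(a,b)$ be a free group on generators $a,b$. Then the spherical conjugacy language $\widetilde\Sigma(F,\{a^{\pm1},b^{\pm1}\})$ is not a context-free language.
   Context: Let $G$ be a group with finite inverse-closed generating set $X$, and let $\pi:X^*\to G$ be the natural projection. Fix a total ordering of $X$ (arbitrary) and let $<_{sl}$ be the induced shortlex ordering on $X^*$ (shorter words first; words of equal length compared lexicographically). For each conjugacy class $c$ of $G$, let $z_c$ be the $<_{sl}$-least word $w\in X^*$ with $\pi(w)\in c$. The spherical conjugacy language is $\widetilde\Sigma(G,X):=\{z_c : c\text{ a conjugacy class of }G\}$. *)

(* Defs.v *)
From HB Require Import structures.
From mathcomp Require Import all_boot finmap.
From Stdlib Require Import Relation_Operators.

Set Implicit Arguments.
Unset Strict Implicit.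
Unset Printing Implicit Defensive.

Local Open Scope fset_scope.
Local Open Scope group_scope.

(* Languages over an alphabet A are predicates [seq A -> Prop]. *)

Record cfg (A : finType) := Cfg {
  nonterm : finType;
  start : nonterm;
  rules : seq (nonterm * seq (nonterm + A))
}.

Definition cfg_step (A : finType) (g : cfg A)
    (u v : seq (nonterm g + A)) : Prop :=
  exists (p q : seq (nonterm g + A)) (N : nonterm g) (rhs : seq (nonterm g + A)),
    [/\ (N, rhs) \in rules g, u = p ++ inl N :: q & v = p ++ rhs ++ q].

Definition cfg_lang (A : finType) (g : cfg A) (w : seq A) : Prop :=
  clos_refl_trans _ (@cfg_step A g) [:: inl (start g)] [seq inr x | x <- w].

Definition context_free (A : finType) (L : seq A -> Prop) : Prop :=
  exists g : cfg A, forall w, L w <-> cfg_lang g w.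

Definition total_order (A : Type) (le : rel A) : Prop :=
  [/\ reflexive le, antisymmetric le, transitive le & total le].

Fixpoint lex_le (A : eqType) (le : rel A) (u v : seq A) : bool :=
  match u, v with
  | [::], _ => true
  | _ :: _, [::] => false
  | x :: u', y :: v' => if x == y then lex_le le u' v' else le x y
  end.

(* The reflexive closure of the strict order <_sl. *)
Definition shortlex_le (A : eqType) (le : rel A) (u v : seq A) : bool :=
  (size u < size v) || ((size u == size v) && lex_le le u v).

Definition free_on (F : groupType) (a b : F) : Prop :=
  forall (H : groupType) (x y : H),
    exists f : {multiplicative F -> H},
      [/\ f a = x, f b = y &
          forall f' : {multiplicative F -> H}, f' a = x -> f' b = y -> f' =1 f].

Section ConjugacyLanguage.
Variables (G : groupType) (X : {fset G}).

Definition word_eval (w : seq X) : G := \prod_(x <- w) val x.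

Definition conj_class (c : G -> Prop) : Prop :=
  exists g : G, forall h : G, c h <-> exists k : G, h = g ^ k.

Definition shortlex_least (le : rel X) (c : G -> Prop) (w : seq X) : Prop :=
  c (word_eval w) /\ forall v : seq X, c (word_eval v) -> shortlex_le le w v.

Definition spherical_conj_lang (le : rel X) (w : seq X) : Prop :=
  exists c : G -> Prop, conj_class c /\ shortlex_least le c w.

End ConjugacyLanguage.

Definition sym_gens (G : groupType) (a b : G) : {fset G} :=
  [fset a; a^-1; b; b^-1].

(* Main.v *)
(* Let x be the least letter and y a letter for the other generator. A word in x
   and y lies in the language only if it is lexicographically below its rotations,
   so x^p y x^q y x^r y is excluded unless p >= q and p >= r. On the other hand
   (x^n y)^3 always lies in the language: mapping x and y to generators of a wreath
   product makes its image central, which pins down the runs of any conjugate word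
   that is not longer.
   In a context-free grammar, choose for each n in a fast growing sequence a
   subtree of a parse tree of (x^n y)^3 whose yield u has length at most n but
   exceeds all previous ones. Two of these subtrees have the same nonterminal and
   the same numbers of y before and inside the yield; exchanging them must stay in
   the language, and this forces the two yields to have equal lengths. *)
Require Import Defs.
From HB Require Import structures.
From mathcomp Require Import all_boot finmap.
From mathcomp Require Import all_order all_algebra zify.
From Stdlib Require Import Relation_Operators Operators_Properties.

Set Implicit Arguments.
Unset Strict Implicit.
Unset Printing Implicit Defensive.

(** * Context-free grammars *)

Section Cfg.
Variables (A : finType) (g : cfg A).
Local Notation sym := (nonterm g + A)%type.

(** Parse forests over a sentential form. Unlike a sequence of rewriting steps, a forest keeps the
    yields of different symbols apart, so that a single subtree can be replaced. *)
Inductive yields : seq sym -> seq A -> Prop :=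
| YieldsNil : yields [::] [::]
| YieldsTerm a f w : yields f w -> yields (inr a :: f) (a :: w)
| YieldsNonterm N rhs f u w : (N, rhs) \in rules g ->
    yields rhs u -> yields f w -> yields (inl N :: f) (u ++ w).

Lemma yields_cat f1 f2 w1 w2 :
  yields f1 w1 -> yields f2 w2 -> yields (f1 ++ f2) (w1 ++ w2).
Proof.
move=> D1 D2; elim: D1 => //= [a f w _ IH|N rhs f u w Nr Du _ _ IH].
  exact: YieldsTerm.
by rewrite -catA; apply: YieldsNonterm Nr Du IH.
Qed.

Lemma yields_split f1 f2 w : yields (f1 ++ f2) w ->
  exists w1 w2, [/\ w = w1 ++ w2, yields f1 w1 & yields f2 w2].
Proof.
elim: f1 w => [|s f1 IH] w /= D; first by exists [::], w; split=> //; constructor.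
inversion D as [|a f w' D' Ea Ew|N rhs f u w' Nr Du D' EN Ew]; subst.
  have [w1 [w2 [-> D1 D2]]] := IH _ D'.
  by exists (a :: w1), w2; split=> //; constructor.
have [w1 [w2 [-> D1 D2]]] := IH _ D'.
exists (u ++ w1), w2; split=> //; first by rewrite catA.
exact: YieldsNonterm Nr Du D1.
Qed.

Lemma yields_terminals w : yields [seq inr x | x <- w] w.
Proof. by elim: w => [|a w IH]; constructor. Qed.

Lemma yields_step f f' w : cfg_step f f' -> yields f' w -> yields f w.
Proof.
case=> p [q] [N] [rhs] [Nr -> ->] /yields_split[w1 [w2 [-> D1]]].
move=> /yields_split[u [w3 [-> Du D3]]].
by apply: yields_cat D1 _; apply: YieldsNonterm Nr Du D3.
Qed.

Local Notation derives := (clos_refl_trans _ (@cfg_step A g)).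

Lemma derives_cat p q f f' : derives f f' -> derives (p ++ f ++ q) (p ++ f' ++ q).
Proof.
elim=> {f f'} [f f' [p' [q' [N [rhs [Nr -> ->]]]]]|f|f1 f2 f3 _ D1 _ D2].
- apply: rt_step; exists (p ++ p'), (q' ++ q), N, rhs.
  by split=> //; rewrite -!catA.
- exact: rt_refl.
- exact: rt_trans D1 D2.
Qed.

Lemma yields_derives f w : yields f w -> derives f [seq inr x | x <- w].
Proof.
elim=> {f w} [|a f w _ IH|N rhs f u w Nr _ IHu _ IHw]; first exact: rt_refl.
  by move/(derives_cat [:: inr a] [::]): IH; rewrite !cats0.
apply: (@rt_trans _ _ _ (rhs ++ f)).
  by apply: rt_step; exists [::], f, N, rhs.
apply: (@rt_trans _ _ _ ([seq inr x | x <- u] ++ f)).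
  exact: (derives_cat [::] f IHu).
by rewrite map_cat; move: (derives_cat [seq inr x | x <- u] [::] IHw); rewrite !cats0.
Qed.

Lemma cfg_langP w : cfg_lang g w <-> yields [:: inl (start g)] w.
Proof.
split; last exact: yields_derives.
move/clos_rt_rt1n_iff; set v := (X in clos_refl_trans_1n _ _ _ X) => D.
have Dv : yields v w by exact: yields_terminals.
by elim: D Dv => // f f1 f2 st _ IH /IH; apply: yields_step st.
Qed.

Definition max_rhs := \max_(r <- rules g) size r.2.

Lemma size_rhs N rhs : (N, rhs) \in rules g -> size rhs <= max_rhs.
Proof. by move=> Nr; rewrite /max_rhs (big_rem _ Nr) leq_maxl. Qed.

(* Descending from the root to a lowest node whose yield is longer than [T]
   gives a yield that is longer than [T] by at most a constant factor. *)
Lemma yields_subtree T f w : 0 < T -> yields f w ->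
  size w <= size f * T \/
  exists (N : nonterm g) (p u s : seq A),
    [/\ w = p ++ u ++ s, T < size u, size u <= max_rhs * T, yields [:: inl N] u &
        forall u', yields [:: inl N] u' -> yields f (p ++ u' ++ s)].
Proof.
move=> T0; elim=> {f w} [|a f w _|N rhs f u w Nr Du IHu Df IHf]; first by left.
  case=> [le|[N [p [u [s [-> lu ul Du sub]]]]]]; [left|right].
    by rewrite /= mulSn -add1n leq_add.
  by exists N, (a :: p), u, s; split=> //= u' /sub; apply: YieldsTerm.
case: IHu => [lu|[M [p [v [s [-> lv vl Dv sub]]]]]]; last first.
  right; exists M, p, v, (s ++ w); split=> //; first by rewrite -!catA.
  by move=> v' /sub D; rewrite 2!catA -(catA p); apply: YieldsNonterm Nr D Df.
have [uT|Tu] := leqP (size u) T; last first.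
  (* This node is chosen itself: its children fell under the first alternative, so its yield is at
     most [max_rhs * T]. *)
  right; exists N, [::], u, w; split=> //.
  - by apply: leq_trans lu _; rewrite leq_mul2r (size_rhs Nr) orbT.
  - by rewrite -[u]cats0; apply: YieldsNonterm Nr Du YieldsNil.
  - by move=> v Dv /=; rewrite -cat1s; apply: yields_cat Dv Df.
case: IHf => [le|[M [p [v [s [-> lv vl Dv sub]]]]]].
  by left; rewrite size_cat /= mulSn leq_add.
right; exists M, (u ++ p), v, s; split=> //; first by rewrite -!catA.
by move=> v' /sub D; rewrite -catA; apply: YieldsNonterm Nr Du D.
Qed.

End Cfg.

(** * Runs between two occurrences of a letter *)

Section Runs.
Variables (A : eqType) (y : A).

(** Runs are indexed by the number of preceding [y]. The value 0 past the last run lets the runs of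
    a concatenation simply add up. *)
Fixpoint run (w : seq A) (b : nat) : nat :=
  if w is l :: w' then
    if l == y then if b is b'.+1 then run w' b' else 0 else (b == 0) + run w' b
  else 0.

(** Both terms can be nonzero only at [b = count_mem y u], where the last run of [u] merges with the
    first run of [v]. *)
Lemma run_cat u v b : run (u ++ v) b =
  run u b + (if count_mem y u <= b then run v (b - count_mem y u) else 0).
Proof.
elim: u b => [|l u IH] b /=; first by rewrite subn0.
case: eqP => _; last by rewrite IH addnA.
by case: b => [|b]; rewrite ?add1n // IH subSS ltnS.
Qed.

Lemma run_count w b : run w b + count_mem y w <= size w.
Proof.
elim: w b => //= l w IH [|b]; case: eqP => _ /=.
- by have := IH 0; lia.
- by have := IH 0; lia.
- by have := IH b; lia.
- by have := IH b.+1; lia.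
Qed.

Lemma run_past w b : count_mem y w < b -> run w b = 0.
Proof.
elim: w b => //= l w IH b; case: eqP => _ lt; last by rewrite IH //; case: b lt.
by case: b lt => // b; rewrite add1n ltnS => /IH.
Qed.

Lemma size_runs w : count_mem y w <= 1 ->
  size w = count_mem y w + run w 0 + run w 1.
Proof.
elim: w => //= l w IH; case: eqP => _ le; last by rewrite IH //=; lia.
have w0 : count_mem y w = 0 by lia.
by rewrite IH ?w0 // (@run_past w 1) ?w0 //=; lia.
Qed.

Lemma runsK (x : A) w : x != y -> {subset w <= [:: x; y]} ->
  w = nseq (run w 0) x ++
      flatten [seq y :: nseq (run w b.+1) x | b <- iota 0 (count_mem y w)].
Proof.
move=> xy; elim: w => // l w IH sub.
have /IH {}IH : {subset w <= [:: x; y]} by move=> z zw; apply: sub; rewrite inE zw orbT.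
move: (sub l (mem_head _ _)); rewrite !inE => /orP[]/eqP -> {l sub}.
  by rewrite /= (negPf xy) /= {1}IH.
rewrite /= eqxx /= {1}IH; congr (_ :: _ ++ _).
by rewrite (iotaDl 1 0) -map_comp.
Qed.

Lemma run_nseq (x : A) n w b : x != y -> run (nseq n x ++ w) b = (b == 0) * n + run w b.
Proof.
move=> xy; elim: n => [|n IH] /=; first by rewrite muln0.
by rewrite (negPf xy) IH mulnS addnA.
Qed.

Lemma count_mem_nseq_neq (x : A) n : x != y -> count_mem y (nseq n x) = 0.
Proof. by move=> xy; rewrite count_nseq /= (negPf xy). Qed.

End Runs.

(** * Cube words and their short factors *)

Definition cube_word (A : Type) (x y : A) (n : nat) : seq A :=
  flatten (nseq 3 (rcons (nseq n x) y)).

Section CubeWord.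
Variables (A : eqType) (x y : A).
Hypothesis xy : x != y.

Lemma cube_wordE n :
  cube_word x y n = nseq n x ++ y :: nseq n x ++ y :: nseq n x ++ [:: y].
Proof. by rewrite /cube_word /= !cat_rcons. Qed.

Lemma run_cube_word n b : run y (cube_word x y n) b = (b < 3) * n.
Proof.
rewrite cube_wordE; case: b => [|[|[|[|b]]]];
by do 4? rewrite ?(run_nseq _ _ _ xy) /= ?eqxx //=; lia.
Qed.

Lemma count_cube_word n : count_mem y (cube_word x y n) = 3.
Proof. by rewrite cube_wordE; do 3! rewrite count_cat (count_mem_nseq_neq _ xy) /= ?eqxx. Qed.

Lemma size_cube_word n : size (cube_word x y n) = n * 3 + 3.
Proof. by rewrite cube_wordE; do 3! rewrite size_cat size_nseq /=; lia. Qed.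

Lemma cube_word_sub n : {subset cube_word x y n <= [:: x; y]}.
Proof.
move=> l; rewrite cube_wordE !(mem_cat, inE, mem_nseq).
by case/or4P=> [/andP[_ ->]|->|/andP[_ ->]|/or3P[->|/andP[_ ->]|->]] //; rewrite ?orbT.
Qed.

(** A factor with two [y] contains a whole inner run of length [n] besides them, hence is longer
    than [n]. *)
Lemma cube_factor_count n p u s : cube_word x y n = p ++ u ++ s ->
  size u <= n -> count_mem y u <= 1.
Proof.
move=> E un; rewrite leqNgt; apply/negP => u2.
have := congr1 (count_mem y) E; rewrite count_cube_word !count_cat => C.
have := congr1 (fun w => run y w (count_mem y p).+1) E.
rewrite run_cube_word !run_cat leqnSn subSnn (run_past (leqnn _)) [count_mem y u <= 1]leqNgt u2 /=.
by have := run_count y u 1; lia.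
Qed.

End CubeWord.

(** * Exchanging factors of two cube words *)

Section SwapFactors.
Variables (A : finType) (x y : A) (L : seq A -> Prop).
Hypothesis xy : x != y.
Hypothesis L_cube : forall n, L (cube_word x y n).
Hypothesis L_runs : forall w, L w -> {subset w <= [:: x; y]} ->
  count_mem y w = 3 -> run y w 3 = 0 -> run y w 1 <= run y w 0 /\ run y w 2 <= run y w 0.

(* If swapping adds [d b] to the [b]-th run of one word, it subtracts [d b] from
   that of the other; both results lie in [L], so [d 0 = d 1 = d 2]. A factor
   with at most one [y] misses one of the three runs, whence [d = 0]. *)
Lemma cube_factor_swap n m p u s p' u' s' :
  cube_word x y n = p ++ u ++ s -> cube_word x y m = p' ++ u' ++ s' ->
  count_mem y p = count_mem y p' -> count_mem y u = count_mem y u' ->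
  size u <= n -> size u' <= m -> L (p ++ u' ++ s) -> L (p' ++ u ++ s') ->
  size u = size u'.
Proof.
move=> E E' cp cu un um Lw Lw'.
have u1 := cube_factor_count xy E un; have u1' := cube_factor_count xy E' um.
rewrite (size_runs u1) (size_runs u1').
have := L_runs Lw; have := L_runs Lw'.
have sub : {subset p ++ u' ++ s <= [:: x; y]}.
  move=> l; rewrite !mem_cat => /or3P[] H.
  - by apply: (@cube_word_sub _ x y n); rewrite E mem_cat H.
  - by apply: (@cube_word_sub _ x y m); rewrite E' !mem_cat H !orbT.
  - by apply: (@cube_word_sub _ x y n); rewrite E !mem_cat H !orbT.
have sub' : {subset p' ++ u ++ s' <= [:: x; y]}.
  move=> l; rewrite !mem_cat => /or3P[] H.
  - by apply: (@cube_word_sub _ x y m); rewrite E' mem_cat H.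
  - by apply: (@cube_word_sub _ x y n); rewrite E !mem_cat H !orbT.
  - by apply: (@cube_word_sub _ x y m); rewrite E' !mem_cat H !orbT.
move=> /(_ sub') + /(_ sub); rewrite !count_cat -cp -cu.
have := congr1 (count_mem y) E; have := congr1 (count_mem y) E'.
rewrite !(count_cube_word xy) !count_cat -cp -cu => C' C.
have R b := etrans (esym (run_cube_word xy n b)) (congr1 (fun w => run y w b) E).
have R' b := etrans (esym (run_cube_word xy m b)) (congr1 (fun w => run y w b) E').
move=> /(_ (esym C')) + /(_ (esym C)).
move: (R 0) (R 1) (R 2) (R 3) (R' 0) (R' 1) (R' 2) (R' 3).
rewrite !run_cat -!cp -!cu.
have ru := @run_past _ y u; have ru' := @run_past _ y u'.
move: (ru 2) (ru 3) (ru' 2) (ru' 3) (ru 1) (ru' 1).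
rewrite -!cu; move: (count_mem y p) (count_mem y u) u1 C => P U.
(* Once the positions of the [y] are numerals, every run equation is linear. *)
case: U => [|[|U]] // _; case: P => [|[|[|[|P]]]] //= _; rewrite ?subSS ?subn0; lia.
Qed.

Lemma cube_words_not_context_free : ~ context_free L.
Proof.
case=> g gP; pose d := (max_rhs g).+1.
(* The intervals from [d ^ i] (excluded) to [d ^ i.+1] are disjoint, so the yields get strictly
   longer with [i]. As [max_rhs g < d], the upper bound follows from that of [yields_subtree]; it
   also makes [u] no longer than a run of its cube word. *)
pose node (i : nat) (D : nonterm g * (seq A * seq A * seq A)) :=
  let: (N, (p, u, s)) := D in
  [/\ cube_word x y (d ^ i.+1) = p ++ u ++ s, d ^ i < size u <= d ^ i.+1,
      yields [:: inl N] u &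
      forall u', yields [:: inl N] u' -> L (p ++ u' ++ s)].
(* One index more than there are triples of a nonterminal and two counts of [y], each at most 3, so
   two indices share a triple. *)
pose I := 'I_#|{: nonterm g * 'I_4 * 'I_4}|.+1.
have [F nodeF] : exists F : I -> _, forall i : I, node i (F i).
  apply: (@fin_all_exists _ _ (fun i : I => node i)) => i; have T0 : 0 < d ^ i by rewrite expn_gt0.
  have [|[N [p [u [s [E lu ul Du sub]]]]]] :=
    yields_subtree T0 ((cfg_langP _ _).1 ((gP _).1 (L_cube (d ^ i.+1)))).
    by rewrite (size_cube_word xy) expnS mul1n; have := leq_pmull (d ^ i) (ltn0Sn _ : 0 < d); lia.
  exists (N, (p, u, s)); split=> // [|u' /sub D]; last by apply/gP/cfg_langP.
  by rewrite lu (leq_trans ul) // expnS leq_mul2r leqnSn orbT.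
pose type i : nonterm g * 'I_4 * 'I_4 := let: (N, (p, u, _)) := F i in
  (N, inord (count_mem y p), inord (count_mem y u)).
suff inj : injective type by have := leq_card _ inj; rewrite card_ord ltnn.
suff le i j : type i = type j -> j <= i.
  by move=> i j E; apply/val_inj/eqP; rewrite eqn_leq !le.
rewrite /type leqNgt => + ; move: (nodeF i) (nodeF j).
case: (F i) (F j) => N [[p u] s] [N' [[p' u'] s']] /=.
case=> E /andP[_ un] Du sub [E' /andP[u'm u'n] Du' sub'] [EN Ep Eu].
have cle n p1 u1 s1 : cube_word x y n = p1 ++ u1 ++ s1 ->
    (count_mem y p1 < 4) && (count_mem y u1 < 4).
  by move/(congr1 (count_mem y)); rewrite (count_cube_word xy) !count_cat; lia.
have [/andP[p4 u4] /andP[p4' u4']] := (cle _ _ _ _ E, cle _ _ _ _ E').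
apply/negP => ij; have : size u < size u'.
  by apply: leq_ltn_trans un (leq_ltn_trans _ u'm); apply: leq_pexp2l.
rewrite (cube_factor_swap E E') ?ltnn //.
- by move: (congr1 val Ep); rewrite /= !inordK.
- by move: (congr1 val Eu); rewrite /= !inordK.
- by apply: sub; rewrite EN.
- by apply: sub'; rewrite -EN.
Qed.

End SwapFactors.

(** * Cube words are shortlex least in their conjugacy class *)

(* The wreath product of [int] by [int], whose top factor acts through ['Z_3]. *)
Definition wreath3 := ({ffun 'Z_3 -> int} * int)%type.
HB.instance Definition _ := Choice.on wreath3.

Section Wreath3.
Import GRing.Theory.
Local Open Scope ring_scope.
Implicit Types p q : wreath3.

Definition wreath3_mul p q : wreath3 :=
  ([ffun i => p.1 i + q.1 (i - p.2%:~R)], p.2 + q.2).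
Definition wreath3_one : wreath3 := ([ffun=> 0], 0).
Definition wreath3_inv p : wreath3 := ([ffun i => - p.1 (i + p.2%:~R)], - p.2).

Fact wreath3_mulA : associative wreath3_mul.
Proof.
move=> p q r; congr pair; last by rewrite /= addrA.
by apply/ffunP=> i; rewrite !ffunE /= addrA intrD opprD addrA.
Qed.

Fact wreath3_mul1g : left_id wreath3_one wreath3_mul.
Proof.
case=> f s; congr pair; last by rewrite /= add0r.
by apply/ffunP=> i; rewrite !ffunE /= add0r subr0.
Qed.

Fact wreath3_mulg1 : right_id wreath3_one wreath3_mul.
Proof.
case=> f s; congr pair; last by rewrite /= addr0.
by apply/ffunP=> i; rewrite !ffunE /= addr0.
Qed.

Fact wreath3_mulVg : left_inverse wreath3_one wreath3_inv wreath3_mul.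
Proof.
case=> f s; congr pair; last by rewrite /= addNr.
by apply/ffunP=> i; rewrite !ffunE /= intrN opprK addNr.
Qed.

Fact wreath3_mulgV : right_inverse wreath3_one wreath3_inv wreath3_mul.
Proof.
case=> f s; congr pair; last by rewrite /= subrr.
by apply/ffunP=> i; rewrite !ffunE /= subrK subrr.
Qed.

HB.instance Definition _ := isGroup.Build wreath3
  wreath3_mulA wreath3_mul1g wreath3_mulg1 wreath3_mulVg wreath3_mulgV.

Definition base_gen : wreath3 := ([ffun i => (i == 0)%:R], 0).
Definition top_gen : wreath3 := ([ffun=> 0], 1).

(** The homomorphism to [int] that sends both generators to 1. On a word in the generators and their
    inverses it is at most the length, with equality only when no inverse occurs. *)
Definition exp_sum p : int := \sum_i p.1 i + p.2.

Lemma exp_sumM p q : exp_sum (p * q)%g = exp_sum p + exp_sum q.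
Proof.
rewrite /exp_sum /=; under eq_bigr do rewrite ffunE.
rewrite big_split /= -!addrA; congr (_ + _); rewrite [RHS]addrCA; congr (_ + _).
rewrite (reindex_inj (addIr (p.2%:~R))) /=.
by apply: eq_bigr => i _; rewrite addrK.
Qed.

Lemma exp_sum1 : exp_sum 1%g = 0.
Proof. by apply: (@addrI _ (exp_sum 1%g)); rewrite -exp_sumM mulg1 addr0. Qed.

Lemma exp_sumV p : exp_sum p^-1%g = - exp_sum p.
Proof. by apply: (@addrI _ (exp_sum p)); rewrite -exp_sumM mulgV exp_sum1 subrr. Qed.

End Wreath3.

Lemma multiplicative1 (G H : groupType) (f : {multiplicative G -> H}) : f 1%g = 1%g.
Proof. by apply: (@mulgI _ (f 1%g)); rewrite -gmulfM !mulg1. Qed.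

Lemma multiplicativeV (G H : groupType) (f : {multiplicative G -> H}) u :
  f u^-1%g = (f u)^-1%g.
Proof. by apply: (@mulgI _ (f u)); rewrite -gmulfM !mulgV multiplicative1. Qed.

Section Least.
Variables (F : groupType) (X : {fset F}) (le : rel X) (x y : X).
Hypothesis hle : total_order le.
Hypothesis x_least : forall l, le x l.
Hypothesis X_letters : forall l : X,
  val l \in [:: val x; (val x)^-1%g; val y; (val y)^-1%g].
Variable phi : {multiplicative F -> wreath3}.
Hypotheses (phix : phi (val x) = base_gen) (phiy : phi (val y) = top_gen).

Lemma least_neq : x != y.
Proof. by apply/eqP=> E; move: phiy; rewrite -E phix => -[]. Qed.

Lemma lex_le_refl (w : seq X) : lex_le le w w.
Proof. by elim: w => //= l w IH; rewrite eqxx. Qed.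

(** If [n < m], the first difference would set [y] on the left against the least letter [x] on the
    right. *)
Lemma lex_le_nseq n m (u v : seq X) :
  lex_le le (nseq n x ++ y :: u) (nseq m x ++ y :: v) -> m <= n.
Proof.
elim: n m => [|n IH] [|m] //=; last by rewrite eqxx => /IH.
case: eqP => [E|_ yx]; first by have := least_neq; rewrite E eqxx.
case: hle => _ anti _ _; have := least_neq.
by rewrite (anti x y) ?eqxx // x_least.
Qed.

Lemma lex_le_more n m (u v : seq X) :
  m < n -> lex_le le (nseq n x ++ u) (nseq m x ++ y :: v).
Proof.
elim: n m => // n IH [|m] /=; last by rewrite eqxx ltnS => /IH.
by rewrite (negPf least_neq) x_least.
Qed.

Lemma word_eval_cat (u v : seq X) :
  word_eval (u ++ v) = (word_eval u * word_eval v)%g.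
Proof. exact: big_cat. Qed.

(** A rotation is a conjugate of the same length, so only the lexicographic comparison remains. *)
Lemma spherical_rot (u v : seq X) :
  spherical_conj_lang le (u ++ v) -> lex_le le (u ++ v) (v ++ u).
Proof.
case=> c [[g cg] [cuv least]]; have /least : c (word_eval (v ++ u)).
  case/cg: cuv => k E; apply/cg; exists (k * word_eval u)%g.
  by rewrite conjgM -E !word_eval_cat /conjg -mulgA mulKg.
by rewrite /shortlex_le !size_cat addnC ltnn eqxx.
Qed.

(** Since the last run is empty, [w] ends in [y]; it is compared with its rotations that start after
    the first and after the second [y]. *)
Lemma spherical_runs (w : seq X) : spherical_conj_lang le w ->
  {subset w <= [:: x; y]} -> count_mem y w = 3 -> run y w 3 = 0 ->
  run y w 1 <= run y w 0 /\ run y w 2 <= run y w 0.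
Proof.
move=> Lw sub c3 r3; have := runsK least_neq sub; rewrite c3 /= r3 /=.
move: (run y w 0) (run y w 1) (run y w 2) => e0 e1 e2 E; rewrite E in Lw; split.
  have := @spherical_rot (nseq e0 x ++ [:: y]) (nseq e1 x ++ y :: nseq e2 x ++ [:: y]).
  by rewrite -!catA /= => /(_ Lw)/lex_le_nseq.
have := @spherical_rot (nseq e0 x ++ y :: nseq e1 x ++ [:: y]) (nseq e2 x ++ [:: y]).
by rewrite -!catA /= -!catA /= => /(_ Lw)/lex_le_nseq.
Qed.

Import GRing.Theory.

Lemma phi_cons l (w : seq X) :
  phi (word_eval (l :: w)) = (phi (val l) * phi (word_eval w))%g.
Proof. by rewrite /word_eval big_cons gmulfM. Qed.

Lemma phi_nil : phi (word_eval ([::] : seq X)) = 1%g.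
Proof. by rewrite /word_eval big_nil multiplicative1. Qed.

Lemma phi_nseq n (w : seq X) i :
  ((phi (word_eval (nseq n x ++ w))).1 i =
   (i == 0)%:R *+ n + (phi (word_eval w)).1 i)%R.
Proof.
elim: n => [|n IH]; first by rewrite mulr0n add0r.
by rewrite /= phi_cons phix ffunE /= subr0 IH ffunE mulrS addrA.
Qed.

Lemma phi_y (w : seq X) i :
  ((phi (word_eval (y :: w))).1 i = (phi (word_eval w)).1 (i - 1))%R.
Proof. by rewrite phi_cons phiy ffunE /= ffunE add0r. Qed.

Lemma phi_count (w : seq X) : {subset w <= [:: x; y]} ->
  (phi (word_eval w)).2 = count_mem y w.
Proof.
elim: w => [|l w IH] sub; first by rewrite phi_nil.
rewrite phi_cons /= IH; last by move=> z zw; apply: sub; rewrite inE zw orbT.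
move: (sub l (mem_head _ _)); rewrite !inE => /orP[]/eqP->.
  by rewrite phix (negPf least_neq) /= add0r.
by rewrite phiy eqxx.
Qed.

Lemma exp_sum_letter l : (exp_sum (phi (val l)) <= 1)%R /\
  (exp_sum (phi (val l)) = 1%R -> l \in [:: x; y]).
Proof.
have tx : exp_sum base_gen = 1%R.
  rewrite /exp_sum (bigD1 ord0) //= big1 ?ffunE ?addr0 // => i /negPf i0.
  by rewrite ffunE -[0%R]/(ord0 : 'Z_3) i0.
have ty : exp_sum top_gen = 1%R.
  by rewrite /exp_sum big1 ?add0r // => i _; rewrite ffunE.
have := X_letters l; rewrite !inE => /or4P[]/eqP E;
  rewrite E ?multiplicativeV ?exp_sumV ?phix ?phiy ?tx ?ty; split=> //.
- by move=> _; rewrite (val_inj E) eqxx.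
- by move=> _; rewrite (val_inj E) eqxx orbT.
Qed.

Lemma exp_sum_word (w : seq X) : (exp_sum (phi (word_eval w)) <= Posz (size w))%R /\
  (exp_sum (phi (word_eval w)) = Posz (size w) -> {subset w <= [:: x; y]}).
Proof.
elim: w => [|l w [le_w sub_w]]; first by rewrite phi_nil exp_sum1.
rewrite phi_cons exp_sumM /=; have [le_l sub_l] := exp_sum_letter l.
have aux (s t : int) k : (s <= 1 -> t <= Posz k -> s + t <= Posz k.+1 /\
    (s + t = Posz k.+1 -> s = 1 /\ t = Posz k))%R by lia.
have [le_lw eq_lw] := aux _ _ _ le_l le_w; split=> // /eq_lw[/sub_l lxy /sub_w wxy].
by move=> z; rewrite inE => /orP[/eqP->|/wxy].
Qed.

(** An [x] preceded by [b] letters [y] adds 1 at coordinate [b] modulo 3; this is why the runs 0 and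
    3 are only seen through their sum. *)
Lemma phi_runs (w : seq X) : {subset w <= [:: x; y]} -> count_mem y w = 3 ->
  [/\ (phi (word_eval w)).1 0%R = Posz (run y w 0 + run y w 3),
      (phi (word_eval w)).1 1%R = Posz (run y w 1) &
      (phi (word_eval w)).1 2%R = Posz (run y w 2)].
Proof.
move=> sub c3; have := runsK least_neq sub; rewrite c3 /= cats0.
move: (run y w 0) (run y w 1) (run y w 2) (run y w 3) => e0 e1 e2 e3 ->.
rewrite -[nseq e3 x]cats0; split; rewrite !(phi_nseq, phi_y) phi_nil ffunE;
rewrite /=; lia.
Qed.

Lemma phi_cube n :
  phi (word_eval (cube_word x y n)) = ([ffun=> Posz n], Posz 3) :> wreath3.
Proof.
have sub := @cube_word_sub _ x y n; have c3 := count_cube_word least_neq n.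
have [f0 f1 f2] := phi_runs sub c3; have := phi_count sub; rewrite c3.
move: f0 f1 f2; rewrite !(run_cube_word least_neq); case: (phi _) => f s /=.
move=> f0 f1 f2 ->; congr pair; apply/ffunP=> i; rewrite ffunE.
case: i => -[|[|[|//]]] lt3.
- by rewrite (_ : Ordinal _ = 0%R) ?f0; [lia|exact: val_inj].
- by rewrite (_ : Ordinal _ = 1%R) ?f1; [lia|exact: val_inj].
- by rewrite (_ : Ordinal _ = 2%R) ?f2; [lia|exact: val_inj].
Qed.

(** Constant functions are invariant under the shift, and the top component 3 acts trivially because
    it vanishes in ['Z_3]. *)
Lemma cube_word_central n p :
  (p * phi (word_eval (cube_word x y n)) = phi (word_eval (cube_word x y n)) * p)%g.
Proof.
rewrite phi_cube; case: p => f s; congr pair; last by rewrite /= addrC.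
apply/ffunP=> i; rewrite !ffunE /= addrC; congr (_ + f _)%R.
by rewrite (_ : 3%:~R = 0)%R ?subr0 //; apply: val_inj.
Qed.

(* A word [v] conjugate to [z] has the image of [z], since that image is central.
   Its exponent sum forces [size z <= size v], and in case of equality [v] is a
   word in [x] and [y] with runs [e0, n, n, e3] where [e0 + e3 = n]. *)
Lemma spherical_cube_word n : spherical_conj_lang le (cube_word x y n).
Proof.
set z := cube_word x y n.
exists (fun h => exists k, h = (word_eval z ^ k)%g); split; first by exists (word_eval z).
split=> [|v [k Ev]]; first by exists 1%g; rewrite conjg1.
have {k Ev} Ev : phi (word_eval v) = phi (word_eval z).
  apply: (@mulgI _ (phi k)); rewrite cube_word_central -!gmulfM Ev.
  by rewrite -conjgC.
have [szv sub] := exp_sum_word v.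
have tz : exp_sum (phi (word_eval z)) = Posz (size z).
  rewrite phi_cube /exp_sum /= (eq_bigr (fun=> Posz n)) => [|i _]; last by rewrite ffunE.
  by rewrite sumr_const card_ord (size_cube_word least_neq) -mulr_natr natz -PoszM -PoszD.
rewrite Ev tz in szv sub.
rewrite /shortlex_le; have [//|/= vz] := ltnP (size z) (size v).
have E : size z = size v by lia.
have {}/sub sub : Posz (size z) = Posz (size v) by rewrite E.
rewrite E eqxx /=.
have c3 : count_mem y v = 3.
  by have := phi_count sub; rewrite Ev phi_cube /=; lia.
have [r0 r1 r2] := phi_runs sub c3; move: r0 r1 r2.
rewrite Ev phi_cube /= !ffunE => r0 r1 r2.
have := runsK least_neq sub; rewrite c3 /= => ->.
have [<- <-] : n = run y v 1 /\ n = run y v 2 by lia.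
(* If run 3 of [v] is empty, then [v] is [z]. Otherwise run 0 of [v] is shorter than [n], and at the
   first difference [z] has [x] where [v] has [y]. *)
rewrite /z cube_wordE; have [r3|r3] := posnP (run y v 3).
  have <- : n = run y v 0 by lia.
  by rewrite r3 lex_le_refl.
by apply: lex_le_more; lia.
Qed.

End Least.

(** * Choice of the two letters and conclusion *)

Lemma least_letters (F : groupType) (a b : F) (le : rel (sym_gens a b)) :
  total_order le -> exists x y : sym_gens a b,
  [/\ forall l, le x l,
      forall l : sym_gens a b,
        val l \in [:: val x; (val x)^-1%g; val y; (val y)^-1%g] &
      free_on a b -> forall (H : groupType) (h k : H),
        exists f : {multiplicative F -> H}, f (val x) = h /\ f (val y) = k].
Proof.
case=> refl_le anti_le trans_le total_le.
have aX : a \in sym_gens a b by rewrite !inE eqxx.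
have bX : b \in sym_gens a b by rewrite !inE eqxx !orbT.
have [x _ x_min] :=
  extremumP id refl_le trans_le total_le (isT : predT [` aX]%fset).
have {}x_min l : le x l by exact: x_min.
(* The least letter may be any of the four. When it is the inverse of a generator, that generator is
   sent to the inverse of the prescribed value. *)
have := valP x; rewrite !inE -!orbA => /or4P[]/eqP Ex.
- exists x, [` bX]%fset; split=> // [l|hF H h k].
    by have := valP l; rewrite !inE Ex -!orbA.
  by have [f [fa fb _]] := hF H h k; exists f; rewrite Ex.
- exists x, [` bX]%fset; split=> // [l|hF H h k].
    by have := valP l; rewrite !inE Ex invgK -!orbA => /or4P[]->; rewrite ?orbT.
  by have [f [fa fb _]] := hF H h^-1%g k; exists f; rewrite Ex multiplicativeV fa invgK.
- exists x, [` aX]%fset; split=> // [l|hF H h k].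
    by have := valP l; rewrite !inE Ex -!orbA => /or4P[]->; rewrite ?orbT.
  by have [f [fa fb _]] := hF H k h; exists f; rewrite Ex.
- exists x, [` aX]%fset; split=> // [l|hF H h k].
    by have := valP l; rewrite !inE Ex invgK -!orbA => /or4P[]->; rewrite ?orbT.
  by have [f [fa fb _]] := hF H k h^-1%g; exists f; rewrite Ex multiplicativeV fb invgK.
Qed.

Theorem proposition2p2 (F : groupType) (a b : F) (hF : free_on a b)
    (le : rel (sym_gens a b)) (hle : total_order le) :
  ~ context_free (spherical_conj_lang le).
Proof.
have [x [y [x_least letters /(_ hF wreath3 base_gen top_gen)[phi [phix phiy]]]]] :=
  least_letters hle.
apply: (@cube_words_not_context_free _ x y); first exact: least_neq phix phiy.
  by move=> n; apply: spherical_cube_word phix phiy n.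
by move=> w; apply: (spherical_runs hle x_least phix phiy).
Qed.
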